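(* Let $G = S_n$ be the symmetric group of degree $n$, with $n \geq 7$. Then $\delta_{\mathcal{S}}(G) = 3$ and every vertex in $\Gamma_{\mathcal{S}}(G)$ is adjacent to an involution.
   Context: For a finite insoluble group $G$ with soluble radical $R(G)$ (the largest soluble normal subgroup; trivial for $S_n$ with $n\ge 5$), the soluble graph $\Gamma_{\mathcal{S}}(G)$ has vertex set $G \setminus R(G)$, with distinct vertices $x,y$ adjacent if and only if the subgroup $\langle x,y\rangle$ is soluble. Its diameter is denoted $\delta_{\mathcal{S}}(G)$ (with $\delta_{\mathcal{S}}(G)=\infty$ if the graph is disconnected). *)

(* Defs.v *)
From mathcomp Require Import all_boot all_fingroup all_solvable.

Set Implicit Arguments.
Unset Strict Implicit.
Unset Printing Implicit Defensive.

Section Distance.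
Variables (T : finType) (e : rel T).

Definition walk (k : nat) (x y : T) : bool :=
  [exists p : k.-tuple T, path e x p && (last x p == y)].

Lemma connect_walk x y : connect e x y -> exists k, walk k x y.
Proof.
case/connectP=> p ep ->; exists (size p).
by apply/existsP; exists (in_tuple p); rewrite ep eqxx.
Qed.

Lemma walk_connect k x y : walk k x y -> connect e x y.
Proof. by case/existsP=> p /andP[ep /eqP <-]; apply/connectP; exists p. Qed.

(* Extended natural numbers are encoded in option nat, None being infinity. *)
Definition dist (x y : T) : option nat :=
  if @idP (connect e x y) is ReflectT xy then Some (ex_minn (connect_walk xy))
  else None.

Definition omax (a b : option nat) : option nat :=
  if (a, b) is (Some m, Some n) then Some (maxn m n) else None.

Definition diameter (V : {set T}) : option nat :=
  \big[omax/Some 0]_(x in V) \big[omax/Some 0]_(y in V) dist x y.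

Lemma dist_leP k x y :
  reflect (exists2 m, m <= k & walk m x y)
          (if dist x y is Some d then d <= k else false).
Proof.
rewrite /dist; case: {-}_ / idP => [xy | nxy].
  case: ex_minnP => d wd min_d; apply: (iffP idP) => [|[m mk /min_d dm]].
    by exists d.
  exact: leq_trans mk.
by apply: ReflectF => -[m _ /walk_connect].
Qed.

End Distance.

Section SolubleGraph.
Local Open Scope group_scope.
Variable gT : finGroupType.
Implicit Types G H : {group gT}.

Definition sol_radical G : {group gT} :=
  (\prod_(H : {group gT} | (H <| G) && solvable H) H)%G.

Lemma sol_radical_normal_sol G :
  (sol_radical G <| G) && solvable (sol_radical G).
Proof.
apply: (big_ind (fun H : {group gT} => (H <| G) && solvable H)) => //=.
  by rewrite normal1 solvable1.
move=> H K /andP[nHG sH] /andP[nKG sK]; rewrite normalY //=.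
have nHK : K \subset 'N(H) := subset_trans (normal_sub nKG) (normal_norm nHG).
rewrite (@series_sol _ _ H) ?normalYl // sH quotientYidl //=.
exact: quotient_sol.
Qed.

Lemma sol_radical_max G H : H <| G -> solvable H -> H \subset sol_radical G.
Proof.
move=> nHG sH; rewrite /sol_radical (bigD1 H) /= ?nHG //.
exact: joing_subl.
Qed.

Definition sol_vertices G : {set gT} := G :\: sol_radical G.

Definition sol_adj G : rel gT :=
  [rel x y | [&& x \in sol_vertices G, y \in sol_vertices G, x != y
               & solvable <<[set x; y]>>]].

Definition sol_diameter G : option nat := diameter (sol_adj G) (sol_vertices G).

End SolubleGraph.

(* Main.v *)
(* Every permutation is inverted by an involution, and two involutions generate a
   dihedral group; this gives an involution adjacent to each vertex and distance
   at most 3.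

   For the lower bound, Bertrand's postulate gives a prime p with
   (n + 2) / 2 <= p <= n - 2. Let x act as a p-cycle c and without fixed points off
   the support of c. A soluble group containing x normalises <c>: otherwise c acts
   nontrivially on some O_q, and an affine-type orbit of size p + 1 = q^j appears,
   whose extra point would be fixed by x. Hence the soluble neighbours z of x act
   on the support as affine maps of Z/p. Take two such x, y whose p-cycles
   (a b X J), (b a X K) share the initial segment {a, b} u X. A common z preserves
   this segment, hence acts on each cycle trivially or by the reflection of the
   segment; the reflections send the last point of X to a, respectively to b, so
   z = 1. The same pair x, y shows that the soluble radical is trivial. *)

Require Import Defs.
From mathcomp Require Import all_boot all_fingroup all_solvable.
From mathcomp Require Import zify.

Set Implicit Arguments.
Unset Strict Implicit.
Unset Printing Implicit Defensive.

(** * Bertrand's postulate *)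

(** A fixed index range allows comparison factor by factor; non-primes contribute [q ^ 0 = 1]. *)
Lemma prod_logn_widen n m : 0 < n -> (forall q, prime q -> q %| n -> q <= m) ->
  n = \prod_(0 <= q < m.+1) q ^ logn q n.
Proof.
move=> n0 nm; rewrite -{1}(partnT n0) (@widen_partn (n + m)) ?leq_addr //.
rewrite (@big_cat_nat _ _ _ m.+1) ?ltnS ?leq_addl //=.
rewrite [X in _ * X = _]big_nat_cond [X in _ * X = _]big1 ?muln1 //.
move=> q /andP[/andP[mq _] _]; rewrite lognE.
by case: and3P => // -[/nm h _ /h]; rewrite leqNgt mq.
Qed.

Lemma prime_dvd_fact q n : prime q -> (q %| n`!) = (q <= n).
Proof.
move=> q_pr; elim: n => [|n IHn]; first by rewrite fact0 Euclid_dvd1 // leqn0 eqn0Ngt prime_gt0.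
rewrite factS Euclid_dvdM // IHn; have [le | lt] := leqP q n.
  by rewrite orbT leqW.
rewrite orbF leq_eqVlt ltnS leqNgt lt orbF; apply/idP/eqP => [/dvdn_leq h | -> //].
by apply/eqP; rewrite eqn_leq h.
Qed.

Lemma central_bin_step k :
  k.+1 * 'C(2 * k.+1, k.+1) = 2 * (2 * k).+1 * 'C(2 * k, k).
Proof.
have e1 := @bin_fact (2 * k) k ltac:(lia).
have e2 := @bin_fact (2 * k.+1) k.+1 ltac:(lia).
rewrite (_ : 2 * k - k = k) in e1; last by lia.
rewrite (_ : 2 * k.+1 - k.+1 = k.+1) in e2; last by lia.
rewrite (_ : 2 * k.+1 = (2 * k).+2) in e2 *; last by lia.
rewrite !factS -e1 in e2.
have f0 : 0 < k.+1 * (k`! * k`!) by rewrite !muln_gt0 fact_gt0.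
apply/eqP; rewrite -(eqn_pmul2r f0); apply/eqP; nia.
Qed.

(** By the recurrence, [k * 'C(2 * k, k)] grows at each step by the factor 2(2k+1)/k >= 4. *)
Lemma central_bin_ge k : 0 < k -> 4 ^ k <= 2 * k * 'C(2 * k, k).
Proof.
elim: k => // -[_ _|k IH _]; first by [].
rewrite -mulnA central_bin_step expnS.
by apply: leq_trans (leq_mul (leqnn 4) (IH isT)) _; nia.
Qed.

(** Consecutive values have ratio 2(2m+3)/(m+2) < 4. *)
Lemma odd_bin_le m : 'C((2 * m).+1, m) <= 4 ^ m.
Proof.
elim: m => // m IH; have e1 := @bin_fact (2 * m).+1 m ltac:(lia).
have e2 := @bin_fact (2 * m.+1).+1 m.+1 ltac:(lia).
rewrite (_ : (2 * m).+1 - m = m.+1) in e1; last by lia.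
rewrite (_ : (2 * m.+1).+1 - m.+1 = m.+2) in e2; last by lia.
rewrite (_ : (2 * m.+1).+1 = (2 * m).+3) in e2 *; last by lia.
rewrite (factS (2 * m).+2) (factS (2 * m).+1) -e1 (factS m.+1) (factS m) in e2.
have f0 : 0 < m.+1 * (m`! * m`!) by rewrite !muln_gt0 fact_gt0.
have e : m.+2 * 'C((2 * m).+3, m.+1) = 2 * (2 * m).+3 * 'C((2 * m).+1, m).
  have f1 : 0 < m.+1 * (m`! * (m.+1 * m`!)) by rewrite !muln_gt0 fact_gt0.
  apply/eqP; rewrite -(eqn_pmul2r f1); apply/eqP; move: e2; nia.
rewrite expnS -(@leq_pmul2l m.+2) // e; nia.
Qed.

Lemma leq_prod_nat (m n : nat) (F G : nat -> nat) :
  (forall i, m <= i < n -> F i <= G i) ->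
  \prod_(m <= i < n) F i <= \prod_(m <= i < n) G i.
Proof.
move=> FG; rewrite big_nat_cond [X in _ <= X]big_nat_cond.
apply: (big_ind2 (fun a b => a <= b)) => // [a b c d|i /andP[/FG]] //.
exact: leq_mul.
Qed.

(* The primes in (m+1, 2m+1] all divide 'C(2m+1, m). *)
Lemma primorial_le n : \prod_(0 <= q < n.+1 | prime q) q <= 4 ^ n.
Proof.
elim/ltn_ind: n => n IH.
have [n2 | n2] := leqP n 2.
  by case: n n2 {IH} => [|[|[|]]] // _; rewrite unlock.
have [odd_n | even_n] := boolP (odd n); last first.
  case: n IH n2 even_n => // n IH n2 en; rewrite big_mkcond big_nat_recr //= -big_mkcond.
  rewrite ifN ?muln1; first by apply: leq_trans (IH n (leqnn _)) _; rewrite leq_exp2l.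
  apply/negP => /even_prime[] e; first by rewrite e in n2.
  by rewrite e in en.
pose m := n./2; have nm : n = (2 * m).+1 by rewrite -[LHS]odd_double_half odd_n mul2n.
have m0 : 0 < m by lia.
(* Induction bounds the primes up to m+1 by [4 ^ m.+1]; the others are bounded by
   ['C(n, m) <= 4 ^ m]. *)
rewrite (@big_cat_nat _ _ _ m.+2) //=; last by lia.
have -> : 4 ^ n = 4 ^ m.+1 * 4 ^ m by rewrite -expnD; congr (_ ^ _); lia.
apply: leq_mul; first by apply: IH; lia.
apply: leq_trans (odd_bin_le m); rewrite -nm; set N := 'C(n, m).
have N0 : 0 < N by rewrite bin_gt0; lia.
have fN : N * (m`! * (n - m)`!) = n`! by rewrite bin_fact //; lia.
have Nle q : prime q -> q %| N -> q <= n.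
  by move=> q_pr qN; rewrite -prime_dvd_fact // -fN dvdn_mulr.
rewrite [leqRHS](prod_logn_widen N0 Nle) [leqRHS](@big_cat_nat _ _ _ m.+2) //=; last by lia.
rewrite -[leqLHS]mul1n leq_mul //.
  apply: prodn_gt0 => q.
  by rewrite expn_gt0 lognE; case: q => //=.
rewrite big_mkcond; apply: leq_prod_nat => q /andP[mq qn].
case: ifP => [q_pr | _]; last by rewrite expn_gt0; case: q mq {qn}.
rewrite -{1}(expn1 q) leq_exp2l ?prime_gt1 // logn_gt0 mem_primes q_pr N0 /=.
have : q %| n`! by rewrite prime_dvd_fact.
by rewrite -fN !Euclid_dvdM // !prime_dvd_fact // => /orP[// | /orP[]]; lia.
Qed.

(** A common bound [N] aligns Legendre's sums for k! and (2k)! term by term. *)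
Lemma logn_fact_widen p n N : prime p -> n < N ->
  logn p n`! = \sum_(1 <= i < N) n %/ p ^ i.
Proof.
move=> p_pr nN; rewrite logn_fact // [RHS](@big_cat_nat _ _ _ n.+1) //=.
rewrite [X in _ + X]big_nat_cond [X in _ + X]big1 ?addn0 // => i /andP[/andP[ni _] _].
by apply: divn_small; apply: ltn_trans (ltn_expl i (prime_gt1 p_pr)).
Qed.

Lemma logn_central_bin p k : logn p 'C(2 * k, k) + 2 * logn p k`! = logn p (2 * k)`!.
Proof.
have e := @bin_fact (2 * k) k ltac:(lia).
rewrite (_ : 2 * k - k = k) in e; last by lia.
rewrite -e !lognM ?muln_gt0 ?fact_gt0 ?bin_gt0 //; last by lia.
by rewrite addnn -mul2n.
Qed.

(** Legendre's formula gives a sum of terms [2k/p^i] - 2[k/p^i], each 0 or 1, and 0 once p^i >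
    2k. *)
Lemma logn_central_bin_le p k : prime p ->
  logn p 'C(2 * k, k) <= trunc_log p (2 * k).
Proof.
move=> p_pr; set L := trunc_log _ _.
rewrite -(leq_add2r (2 * logn p k`!)) logn_central_bin addnC.
rewrite !(@logn_fact_widen p _ (2 * k).+1) //; last by lia.
have small N : \sum_(1 <= i < N.+1) (i <= L : nat) <= minn N L.
  elim: N => [|N IH]; first by rewrite big_geq.
  by rewrite big_nat_recr //=; case: leqP => ?; lia.
apply: leq_trans (leq_add (leqnn _) (leq_trans (small (2 * k)) (geq_minr _ _))).
rewrite big_distrr -big_split /=; apply: leq_sum => i _.
have pi0 : 0 < p ^ i by rewrite expn_gt0 prime_gt0.
have [pik | kpi] := leqP (p ^ i) (2 * k).
  rewrite (trunc_log_max (prime_gt1 p_pr) pik) -ltnS ltn_divLR //.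
  by have := divn_eq k (p ^ i); have := ltn_pmod k pi0; nia.
by rewrite divn_small.
Qed.

Lemma prime_central_bin_pow_le p k : 0 < k -> prime p ->
  p ^ logn p 'C(2 * k, k) <= 2 * k.
Proof.
move=> k0 p_pr; apply: leq_trans (trunc_logP (prime_gt1 p_pr) _); last by lia.
by rewrite leq_exp2l ?prime_gt1 // logn_central_bin_le.
Qed.

(** Since p^2 >= 3p > 2k, Legendre's sum for (2k)! reduces to its first term, at most 2, while k!
    contributes at least 1, subtracted twice. *)
Lemma logn_central_bin_eq0 p k : prime p -> 2 < p -> 2 * k < 3 * p -> p <= k ->
  logn p 'C(2 * k, k) = 0.
Proof.
move=> p_pr p3 kp pk; have := logn_central_bin p k.
have : 1 <= logn p k`! by rewrite logn_gt0 mem_primes p_pr fact_gt0 prime_dvd_fact.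
suff : logn p (2 * k)`! <= 2 by lia.
rewrite logn_fact // big_nat_recl //=; last by lia.
rewrite [X in _ + X]big_nat_cond [X in _ + X]big1 ?addn0.
  by rewrite expn1 -ltnS ltn_divLR ?prime_gt0.
move=> i /andP[/andP[i1 _] _]; apply: divn_small; apply: leq_trans kp _.
rewrite expnS mulnC leq_mul2l; apply/orP; right.
by apply: leq_trans p3 _; rewrite -{1}(expn1 p) leq_exp2l ?prime_gt1.
Qed.

(* Erdos: prime powers in 'C(2k, k) are at most 2k, primes above s = sqrt (2k)
   occur at most once, and those in (2k/3, k] do not occur. A prime equal to k+1
   is allowed and accounts for one more factor 2k. *)
Lemma central_bin_le k s : 2 < k -> (forall p, prime p -> k.+1 < p -> 2 * k < p) ->
  2 * k < s.+1 ^ 2 -> s <= 2 * k ->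
  'C(2 * k, k) <= (2 * k) ^ s.+2 * 4 ^ (2 * k %/ 3).
Proof.
move=> k2 noprime ks sk; set N := 'C(_, _).
have k0 : 0 < k by lia.
have N0 : 0 < N by rewrite bin_gt0; lia.
have Nle q : prime q -> q %| N -> q <= 2 * k.
  move=> q_pr qN; rewrite -prime_dvd_fact //.
  by rewrite -(@bin_fact (2 * k) k) ?dvdn_mulr //; lia.
rewrite [leqLHS](prod_logn_widen N0 Nle).
(* The q <= s give s+1 factors 2k and q = k+1 one more, whence the exponent [s.+2]. *)
pose F q := (if q < s.+1 then 2 * k else 1) * (if q == k.+1 then 2 * k else 1)
   * (if prime q && (q < (2 * k %/ 3).+1) then q else 1).
apply: (@leq_trans (\prod_(0 <= q < (2 * k).+1) F q)).
  apply: leq_prod_nat => q /andP[_ qk]; rewrite /F.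
  have [q_pr | nq] := boolP (prime q); last first.
    rewrite lognE (negPf nq) expn0 muln1.
    by case: ifP; case: ifP => _ _; rewrite ?muln1 ?mul1n ?muln_gt0 ?k0.
  have q0 := prime_gt0 q_pr.
  have pow := prime_central_bin_pow_le k0 q_pr; rewrite -/N in pow.
  have d3 : (q < (2 * k %/ 3).+1) = (q * 3 <= 2 * k) by rewrite ltnS leq_divRL.
  have [qs | sq] := ltnP q s.+1.
    apply: leq_trans pow _; rewrite -mulnA leq_pmulr // muln_gt0.
    by case: ifP; case: ifP => _ _; rewrite ?muln_gt0 ?k0 ?q0.
  have [_ | qk1] := eqVneq q k.+1.
    by rewrite mul1n; apply: leq_trans pow _; rewrite leq_pmulr //; case: ifP.
  (* Now q > s, so q^2 > 2k and the exponent is at most 1; if also 3q > 2k, it is 0. *)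
  rewrite !mul1n d3 /=; case: ifP => [_ | /negbT q3].
    rewrite -[leqRHS]expn1 leq_exp2l ?prime_gt1 //.
    apply: leq_trans (logn_central_bin_le k q_pr) _.
    rewrite -ltnS -(ltn_exp2l _ _ (prime_gt1 q_pr)).
    apply: leq_ltn_trans (trunc_logP (prime_gt1 q_pr) _) _; first by lia.
    by apply: leq_trans ks _; rewrite leq_exp2r.
  rewrite logn_central_bin_eq0 //; try lia.
  by rewrite leqNgt; apply/negP => kq; have := noprime q q_pr; lia.
rewrite /F !big_split /= [(2 * k) ^ _]expnSr; apply: leq_mul; first apply: leq_mul.
- rewrite -big_mkcond /= -(@big_nat_widen _ _ _ _ _ _ xpredT) //.
  by rewrite prod_nat_const_nat subn0.
- rewrite (bigD1_seq k.+1) ?iota_uniq ?mem_index_iota /=; try lia.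
  by rewrite eqxx big1 ?muln1 // => q /negPf ->.
- rewrite -big_mkcond /= -(@big_nat_widen _ _ _ _ _ _ prime) ?primorial_le //; lia.
Qed.

Lemma exists_sqrtn N : exists s, s ^ 2 <= N < s.+1 ^ 2.
Proof.
elim: N => [|N [s /andP[sN Ns]]]; first by exists 0.
have [le | lt] := leqP (s.+1 ^ 2) N.+1; [exists s.+1 | exists s]; nia.
Qed.

Lemma lt_of_no_bertrand k : 2 < k -> (forall p, prime p -> k.+1 < p -> 2 * k < p) ->
  2 * k < 64 ^ 2.
Proof.
move=> k2 noprime; rewrite ltnNge; apply/negP => kbig.
have [s /andP[sk ks]] := exists_sqrtn (2 * k).
have s64 : 64 <= s by rewrite leqNgt; apply/negP => s64; nia.
have sk' : s <= 2 * k by nia.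
have := central_bin_ge (ltnW (ltnW k2)).
move=> h; have {h} := leq_trans h (leq_mul (leqnn _) (central_bin_le k2 noprime ks sk')).
(* [L] is the bit length of [s], so 2k < 2^(2L), and 64 <= s gives 8L <= s. Comparing exponents of 2
   yields 2k/3 <= 2L(s+3) <= s(s+3)/4, against s^2 <= 2k. *)
rewrite mulnA -expnS; pose L := (trunc_log 2 s).+1.
have sL : s < 2 ^ L by apply: trunc_log_ltn.
have s0 : 0 < s by lia.
have Ls : 2 ^ L.-1 <= s by apply: trunc_logP.
have L6 : 6 <= L.-1 by apply: trunc_log_max.
have L8 : 8 * L <= s.
  apply: leq_trans Ls; rewrite /L /= in L6 *; move: (trunc_log 2 s) L6 => {L sL s64 s0} m.
  elim: m => // m IH; rewrite leq_eqVlt => /orP[/eqP <- // | m6].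
  by have := IH m6; rewrite expnS; lia.
have kL : (2 * k) ^ s.+3 <= 2 ^ (2 * L * s.+3).
  rewrite expnM leq_exp2r // ltnW //; apply: leq_trans ks _.
  by rewrite mulnC expnM leq_exp2r.
move=> h; have {h} := leq_trans h (leq_mul kL (leqnn _)).
rewrite -[4]/(2 ^ 2) -!expnM -expnD leq_exp2l //.
have := leq_divM (2 * k) 3; nia.
Qed.

Lemma bertrand_strong k : 2 < k -> exists2 p, prime p & k.+1 < p <= 2 * k.
Proof.
move=> k2; have [ge | lt] := leqP (64 ^ 2) (2 * k).
  have [/hasP[p] | no] := boolP (has prime (iota k.+2 k.-1)).
    by rewrite mem_iota => pk p_pr; exists p => //; lia.
  have := @lt_of_no_bertrand k k2; rewrite ltnNge ge => H; suff : false by [].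
  apply: H => p p_pr kp; rewrite ltnNge; apply: contra no => pk.
  by apply/hasP; exists p => //; rewrite mem_iota; lia.
(* Each prime p below settles the k with p/2 <= k <= p - 2; these ranges cover 2 < k < 2048. *)
have try p : prime p -> k.+1 < p -> p <= 2 * k -> exists2 p, prime p & k.+1 < p <= 2 * k.
  by move=> p_pr kp pk; exists p => //; rewrite kp pk.
have k2048 : k < 2048 by lia.
have [?|?] := ltnP k 4; first by apply: (try 5) => //; lia.
have [?|?] := ltnP k 6; first by apply: (try 7) => //; lia.
have [?|?] := ltnP k 10; first by apply: (try 11) => //; lia.
have [?|?] := ltnP k 18; first by apply: (try 19) => //; lia.
have [?|?] := ltnP k 30; first by apply: (try 31) => //; lia.
have [?|?] := ltnP k 58; first by apply: (try 59) => //; lia.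
have [?|?] := ltnP k 112; first by apply: (try 113) => //; lia.
have [?|?] := ltnP k 222; first by apply: (try 223) => //; lia.
have [?|?] := ltnP k 442; first by apply: (try 443) => //; lia.
have [?|?] := ltnP k 880; first by apply: (try 881) => //; lia.
have [?|?] := ltnP k 1752; first by apply: (try 1753) => //; lia.
by apply: (try 3499) => //; lia.
Qed.

(** With k one less than n/2 rounded up, k+2 <= p <= 2k <= n-1; p is not the even number 2k, so p <=
    n-2. *)
Lemma bertrand_shifted n : 7 <= n ->
  exists2 p, prime p & (n + 2 <= 2 * p) && (p + 2 <= n).
Proof.
move=> n7; have [|p p_pr kp] := @bertrand_strong (uphalf n).-1; first by lia.
exists p => //; have : p != 2 * (uphalf n).-1; last by lia.
apply: contraTneq p_pr => ->; apply/negP => /even_prime[]; last by rewrite oddM.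
by lia.
Qed.

(** * Soluble permutation groups containing a p-cycle *)

Section FixedPoints.
Local Open Scope group_scope.

Lemma cent_sub_Fitting (gT : finGroupType) (G : {group gT}) :
  solvable G -> 'C_G('F(G)) \subset 'F(G).
Proof.
move=> solG; set C := 'C_G('F(G)).
have nCG : C <| G by rewrite /normal subsetIl normsI ?normG ?norms_cent ?gFnorm.
have solC : solvable C := solvableS (normal_sub nCG) solG.
have [N CN1] := derivedP _ solC.
(* Ascends the derived series of [C], from its trivial term [N] to [C] itself. *)
suff H k : k <= N -> C^`(N - k) \subset 'F(G) by rewrite -[C]derg0 -(subnn N) H.
elim: k => [|k IHk] kN; first by rewrite subn0 CN1 sub1G.
(* [D, D] lies in both C and F(G), hence is central in D: D has class <= 2. *)
have {IHk} := IHk (ltnW kN); rewrite -(subnSK kN) dergSn.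
set D := C^`(N - k.+1) => DF.
have nDG : D <| G := char_normal_trans (der_char _ _) nCG.
apply: Fitting_max => //; apply/lcnP; exists 2.
rewrite lcnSn lcn2; apply/commG1P; apply: subset_trans DF _.
rewrite centsC; apply: subset_trans (der_sub _ _) (subsetIr _ _).
Qed.

Lemma logn_fact_le1 p n : prime p -> n < 2 * p -> logn p n`! <= 1.
Proof.
move=> p_pr n2p; rewrite logn_fact //; case: n n2p => [|n] n2p.
  by rewrite big_geq.
rewrite big_nat_recl // big_nat big1 ?addn0 => [|k /andP[k1 _]].
  by rewrite expn1 -ltnS ltn_divLR ?prime_gt0.
apply: divn_small; apply: leq_trans n2p _.
by rewrite expnS leq_mul ?prime_gt1 // -{1}(expn1 p) leq_exp2l ?prime_gt1.
Qed.

Variable T : finType.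
Implicit Types (c x : {perm T}) (H K : {group {perm T}}).

(** As #|T| < 2p, p divides #|T|! only once, so a subgroup of order p is already Sylow. *)
Lemma cycle_Sylow_perm p c H : prime p -> #|T| < 2 * p -> c \in H ->
  #[c] = p -> p.-Sylow(H) <[c]>.
Proof.
move=> p_pr T2p cH oc; rewrite pHallE cycle_subG cH /= -orderE oc.
have p_dv : p %| #|H| by rewrite -oc order_dvdG.
rewrite p_part; suff -> : logn p #|H| = 1%N by rewrite expn1.
apply/eqP; rewrite eqn_leq -(pfactor_dvdn 1 p_pr (cardG_gt0 H)) expn1 p_dv andbT.
apply: leq_trans (logn_fact_le1 p_pr T2p); apply: dvdn_leq_log => //.
  exact: fact_gt0.
rewrite -cardsT -card_perm; apply: dvdn_trans (cardSg (subsetT H)) _.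
rewrite (@eq_card _ (perm_on _) (mem [set: {perm T}])) // => s.
by rewrite [LHS]unfold_in inE; apply/subsetP => t; rewrite !inE.
Qed.

(* By Sylow's theorem in point stabilisers, the normaliser of <[c]> in K is
   transitive on F. *)
Lemma card_fix_dvdn p K c a : p.-Sylow(K) <[c]> ->
  let F := [set t in orbit 'P K a | c t == t] in
  F != set0 -> #|F| %| #|K|.
Proof.
move=> sylP F /set0Pn[t tF].
suff -> : F = orbit 'P 'N_K(<[c]>) t.
  apply: dvdn_trans (cardSg (subsetIl K 'N(<[c]>))).
  by rewrite -(card_orbit_stab 'P _ t) dvdn_mulr.
have cK : c \in K by rewrite -cycle_subG (pHall_sub sylP).
have sylst u : u \in F -> p.-Sylow('C_K[u | 'P]) <[c]>.
  rewrite inE => /andP[_ /eqP cu].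
  apply: pHall_subl _ (subsetIl _ _) sylP; rewrite cycle_subG inE cK /=.
  by apply/astab1P; rewrite /= apermE cu.
have /[!inE] /andP[tO /eqP ct] := tF.
apply/setP => u; apply/idP/orbitP => [uF | [g gN <-]].
  have /[!inE] /andP[uO /eqP cu] := uF.
  have /orbitP[g gK gt] : u \in orbit 'P K t.
    by apply: orbit_trans uO _; rewrite orbit_sym.
  have sylg : p.-Sylow('C_K[u | 'P]) (<[c]> :^ g).
    rewrite -gt astab1_act -(conjGid gK) -conjIg pHallJ2; exact: sylst.
  have [h hK e] := Sylow_trans (sylst u uF) sylg.
  have [hK' hu] := setIP hK.
  exists (g * h^-1).
    rewrite inE groupM ?groupV //=; apply/normP.
    by rewrite conjsgM -/(_ :^ g) e -conjsgM mulgV conjsg1.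
  by rewrite actM gt; apply/astab1P; rewrite groupV.
have [gK gc] := setIP gN.
rewrite inE (orbit_actr 'P _ _ gK) tO /= /aperm -permM.
have : c ^ g^-1 \in <[c]> by rewrite -mem_conjg (normP gc) cycle_id.
case/cycleP => k ck; rewrite (conjgCV g) ck permM.
by rewrite permX_fix.
Qed.

(** Nontrivial orbits of <[c]> have size p, and two of them do not fit into fewer than 2p points. *)
Lemma support_orbit p c a : prime p -> #|T| < 2 * p -> #[c] = p ->
  c a != a -> [set t | c t != t] = orbit 'P <[c]> a.
Proof.
move=> p_pr T2p oc ca.
have moved b d : c b != b -> d \in <[c]> -> c (d b) != d b.
  move=> cb /cycleP[k ->]; rewrite -permM -(commuteX k (commute_refl c)) permM.
  by rewrite (inj_eq perm_inj).
have card_orb b : c b != b -> #|orbit 'P <[c]> b| = p.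
  move=> cb; have := card_orbit_stab 'P <[c]> b; rewrite -orderE oc => e.
  have : #|orbit 'P <[c]> b| %| p by rewrite -e dvdn_mulr.
  move=> dv; apply/(prime_nt_dvdP p_pr): dv; apply/eqP => /card_orbit1 /setP/(_ (c b)).
  rewrite inE (negPf cb) => /negP[]; apply/orbitP; exists c => //.
  exact: cycle_id.
apply/setP => b; rewrite inE; apply/idP/orbitP => [cb | [d dc <-]]; last first.
  exact: moved.
suff : b \in orbit 'P <[c]> a by move/orbitP.
apply: contraLR T2p => nb; rewrite -leqNgt mul2n -addnn.
rewrite -{1}(card_orb a ca) -(card_orb b cb).
have /leqifP := leq_card_setU (orbit 'P <[c]> a) (orbit 'P <[c]> b).
case: ifP => [_ /eqP <- | /negbT/pred0Pn[t /andP[/= ta tb]]]; first exact: max_card.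
by case/negP: nb; apply: orbit_trans ta; rewrite orbit_sym.
Qed.

Lemma card_support p c a : prime p -> #|T| < 2 * p -> #[c] = p ->
  c a != a -> #|[set t | c t != t]| = p.
Proof.
move=> p_pr T2p oc ca; have := card_orbit_stab 'P <[c]> a.
rewrite -(support_orbit p_pr T2p oc ca) -orderE oc => e.
have : #|[set t | c t != t]| %| p by rewrite -e dvdn_mulr.
move=> dv; apply/(prime_nt_dvdP p_pr): dv; apply/eqP => /eqP/cards1P[b bE].
have /set1P ab : a \in [set b] by rewrite -bE inE.
have /set1P cab : c a \in [set b] by rewrite -bE inE (inj_eq perm_inj).
by rewrite cab ab eqxx in ca.
Qed.

(* If <[c]> is not normal in H, then c moves some Q = O_q(H), q <> p. The orbit D
   of K = Q <[c]> containing the p-cycle has size q^j, and its f = #|D| - p points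
   fixed by c are permuted transitively by a {p, q}-group, so f is a power of q;
   as q does not divide p, f = 1, and x must fix that single point. *)
Lemma sub_norm_cycle_of_sol p H c x : prime p -> #|T| < 2 * p -> solvable H ->
  c \in H -> #[c] = p -> x \in H -> commute x c -> (forall t, x t != t) ->
  H \subset 'N(<[c]>).
Proof.
move=> p_pr T2p solH cH oc xH xc xfree.
have sylH := cycle_Sylow_perm p_pr T2p cH oc.
(* If c centralises every O_q(H), it centralises F(H), hence lies in it, and <[c]> = O_p(H) is
   normal. *)
have [cF | ] := boolP [forall (q : 'I_#|H|.+1 | (q : nat) \in \pi(H)), c \in 'C('O_q(H))].
  have {}cF : c \in 'F(H).
    apply: (subsetP (cent_sub_Fitting solH)); rewrite inE cH FittingEgen cent_gen.
    rewrite -sub1set centsC; apply/bigcupsP => q qH.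
    by rewrite centsC sub1set; exact: (forall_inP cF).
  suff <- : 'O_p(H) = <[c]> by rewrite gFnorm.
  apply/eqP; rewrite eqEsubset (pcore_sub_Hall sylH) cycle_subG /= -p_core_Fitting.
  by rewrite (mem_normal_Hall (nilpotent_pcore_Hall p (Fitting_nil H))) ?gFnormal
    // /p_elt oc pnat_id.
case/forall_inPn => -[q /= ltqH] qH ncQ; pose Q := 'O_q(H)%G.
have q_pr : prime q by move: qH; rewrite -topredE /= mem_primes => /andP[].
have qQ : q.-group Q := pcore_pgroup q H.
have neq_qp : q != p.
  apply: contraNneq ncQ => ->; rewrite -sub1set centsC.
  apply: subset_trans (pcore_sub_Hall sylH) _.
  by rewrite cent_set1 cycle_subG cent1id.
have nQH : H \subset 'N(Q) := gFnorm _ _.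
pose K := (Q <*> <[c]>)%G.
have coQp : coprime #|Q| p.
  by rewrite (pnat_coprime qQ) // pnatE // !inE eq_sym.
have cK : c \in K by rewrite mem_gen // inE cycle_id orbT.
have oK : #|K| = (#|Q| * p)%N.
  rewrite /K /= norm_joinEr ?cycle_subG ?(subsetP nQH) //.
  by rewrite coprime_cardMg -?orderE oc.
have [a ca] : exists a, c a != a.
  apply/existsP; apply: contraR ncQ; rewrite negb_exists => /forallP c1.
  suff -> : c = 1 by rewrite group1.
  by apply/permP => t; rewrite perm1; apply/eqP; rewrite -[_ == _]negbK.
pose A := [set t | c t != t]; pose D := orbit 'P K a.
have oA : #|A| = p := card_support p_pr T2p oc ca.
have AD : A \subset D.
  by rewrite /A (support_orbit p_pr T2p oc ca) imsetS // cycle_subG.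
have D2p : #|D| < 2 * p := leq_ltn_trans (max_card _) T2p.
have dvD : #|D| %| #|Q| * p by rewrite -oK -(card_orbit_stab 'P _ a) dvdn_mulr.
(* If p divides #|D|, then D = A. Stabilisers of points of A are Sylow q-subgroups of K, so contain
   the normal subgroup Q; thus Q fixes the support of c pointwise and centralises c, a
   contradiction. *)
have [pD | npD] := boolP (p %| #|D|).
  have DA : D = A.
    apply/esym/eqP; rewrite eqEcard AD oA.
    have /dvdnP[k e] := pD; move: D2p; rewrite e ltn_pmul2r ?prime_gt0 // ltnS.
    by rewrite -{2}(mul1n p) leq_pmul2r ?prime_gt0.
  have fixQ b : b \in A -> Q \subset 'C_K[b | 'P].
    rewrite -DA => bD; have oC : #|'C_K[b | 'P]| = #|Q|.
      have := card_orbit_stab 'P K b.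
      rewrite (orbit_eqP bD) -/D DA oA oK mulnC => /eqP.
      by rewrite eqn_pmul2r ?prime_gt0 // => /eqP.
    have sylC : q.-Sylow(K) 'C_K[b | 'P].
      rewrite pHallE subsetIl oC oK partnM ?cardG_gt0 ?prime_gt0 //.
      have q'p : q^'.-nat p by rewrite pnatE // !inE eq_sym.
      by rewrite part_pnat_id // part_p'nat // muln1 eqxx.
    apply: subset_trans (pcore_sub_Hall sylC); apply: pcore_max => //.
    rewrite /normal joing_subl join_subG normG cycle_subG; exact: (subsetP nQH).
  case/negP: ncQ; apply/centP => u uQ; apply/permP => t; rewrite !permM.
  have fixu b : b \in A -> u b = b.
    by move=> bA; have /setIP[_ /astab1P] := subsetP (fixQ b bA) _ uQ.
  have [tA | ] := boolP (t \in A).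
    by rewrite !fixu // inE (inj_eq perm_inj); rewrite inE in tA.
  move=> tA; have utA : u t \notin A.
    by apply: contra tA => utA; rewrite -(perm_inj (fixu _ utA)).
  by move: tA utA; rewrite !inE !negbK => /eqP -> /eqP ->.
pose F := [set t in D | c t == t].
have oD : #|D| = (p + #|F|)%N.
  rewrite -(cardsID A D) (setIidPr AD) oA; congr (_ + _)%N; apply: eq_card => t.
  by rewrite !inE negbK andbC.
have Fp : #|F| < p by move: D2p; rewrite oD mul2n -addnn ltn_add2l.
have F0 : F != set0.
  by apply: contraNneq npD => F0; rewrite oD F0 cards0 addn0.
have Fpos : 0 < #|F| by rewrite card_gt0.
have sylK : p.-Sylow(K) <[c]> := cycle_Sylow_perm p_pr T2p cK oc.
have FQ : #|F| %| #|Q|.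
  have := card_fix_dvdn sylK F0; rewrite oK Gauss_dvdl // coprime_sym.
  by rewrite prime_coprime // gtnNdvd.
have DQ : #|D| %| #|Q|.
  by move: dvD; rewrite Gauss_dvdl // coprime_sym prime_coprime.
have qdv m : m %| #|Q| -> m != 1%N -> q %| m.
  move=> mQ m1; have /p_natP[[|k] e] := pnat_dvd mQ qQ; first by rewrite e in m1.
  by rewrite e expnS dvdn_mulr.
have [F1 | F1] := eqVneq #|F| 1%N.
  have /eqP/cards1P[t Ft] := F1.
  have : t \in F by rewrite Ft inE.
  rewrite inE => /andP[/orbitP[g gK gt] /eqP ct].
  (* [x] normalises K and sends [a] into D, so it preserves D; commuting with [c], it preserves
     F. *)
  have : x t \in F.
    have xA : x a \in A.
      by rewrite inE -permM xc permM (inj_eq perm_inj).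
    rewrite inE -permM xc permM ct eqxx andbT -gt /= /aperm -permM conjgC permM.
    have xK : x \in 'N(K).
      rewrite -sub1set normsY ?sub1set ?(subsetP nQH) //.
      by rewrite (subsetP (cent_sub _)) // cent_cycle; apply/cent1P.
    have gxK : g ^ x \in K by rewrite memJ_norm.
    have := orbit_actr 'P a (x a) gxK.
    by rewrite /= /aperm => ->; exact: (subsetP AD).
  by rewrite Ft inE (negPf (xfree t)).
(* If f > 1, then q divides both f and #|D| = p + f, hence p. *)
case/eqP: neq_qp; apply/eqP; rewrite -dvdn_prime2 // -(dvdn_addl _ (qdv _ FQ F1)).
rewrite -oD qdv //; apply: contraTneq (prime_gt1 p_pr) => D1.
by rewrite -leqNgt -D1 oD leq_addr.
Qed.

End FixedPoints.

(** * Cycles given by lists, and the normalisers of the groups they generate *)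

Section CyclePerm.
Local Open Scope group_scope.
Variable T : finType.
Implicit Types (s : seq T) (t : T) (z : {perm T}).

(** The underlying function is [next s], inferred from the cancellation [prev_next]. *)
Definition cycle_perm s (Us : uniq s) : {perm T} := perm (can_inj (prev_next Us)).

Lemma cycle_perm_fix s (Us : uniq s) t : t \notin s -> cycle_perm Us t = t.
Proof. by move=> ts; rewrite permE next_nth (negPf ts). Qed.

Lemma cycle_perm_nth s (Us : uniq s) x0 i : i < size s ->
  cycle_perm Us (nth x0 s i) = nth x0 s (i.+1 %% size s).
Proof.
move=> ltis; rewrite permE next_nth mem_nth // index_uniq //.
case: s Us ltis => //= y s _; rewrite ltnS leq_eqVlt => /orP[/eqP -> | ltis].
  by rewrite modnn /= nth_default.
by rewrite modn_small //=; apply: set_nth_default.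
Qed.

Lemma cycle_permX_nth s (Us : uniq s) x0 i k : i < size s ->
  (cycle_perm Us ^+ k) (nth x0 s i) = nth x0 s ((i + k) %% size s).
Proof.
move=> ltis; elim: k => [|k IHk]; first by rewrite expg0 perm1 addn0 modn_small.
rewrite expgSr permM IHk cycle_perm_nth ?ltn_mod; last exact: leq_ltn_trans ltis.
by rewrite -(addn1 (_ %% _)) modnDml addn1 addnS.
Qed.

Lemma cycle_perm_size s (Us : uniq s) : cycle_perm Us ^+ size s = 1.
Proof.
apply/permP => t; rewrite perm1; have [ts | ts] := boolP (t \in s); last first.
  by rewrite permX_fix // cycle_perm_fix.
have /(nthP t)[i ltis ti] := ts.
by rewrite -ti cycle_permX_nth // modnDr modn_small.
Qed.

Lemma cycle_perm_moved s (Us : uniq s) t : 1 < size s ->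
  (cycle_perm Us t != t) = (t \in s).
Proof.
move=> s1; have [ts | /cycle_perm_fix -> //] := boolP (t \in s); last by rewrite eqxx.
have /(nthP t)[i ltis ti] := ts; rewrite -ti cycle_perm_nth //.
rewrite nth_uniq ?ltn_mod //; last exact: ltnW.
have [lt | ge | e] := ltngtP i.+1 (size s).
- by rewrite modn_small // neq_ltn ltnSn orbT.
- by move: ge; rewrite ltnNge ltis.
- by rewrite e modnn; case: (i) e s1 => // <-.
Qed.

Lemma order_cycle_perm s (Us : uniq s) : prime (size s) ->
  #[cycle_perm Us] = size s.
Proof.
move=> p_pr; apply: nt_prime_order => //; first exact: cycle_perm_size.
have s1 := prime_gt1 p_pr; case: s Us p_pr s1 => // t s Us _ s1.
apply: contraTneq (mem_head t s) => c1.
by rewrite -(cycle_perm_moved Us) // c1 perm1 eqxx.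
Qed.

(** The conjugate of the cycle by [z] is a power of the cycle, so fixes whatever the cycle fixes. *)
Lemma norm_cycle_perm_mem s (Us : uniq s) z t : 1 < size s ->
  z \in 'N(<[cycle_perm Us]>) -> t \in s -> z t \in s.
Proof.
move=> s1 zN ts; apply: contraLR (ts) => zts.
have : cycle_perm Us ^ z \in <[cycle_perm Us]> by rewrite memJ_norm ?cycle_id.
case/cycleP => k ck; rewrite -(cycle_perm_moved Us) // negbK.
by rewrite -(inj_eq (@perm_inj _ z)) -permJ ck permX_fix ?cycle_perm_fix.
Qed.

(* An affine map of Z/p preserving the interval {0, ..., l-1}, 2 <= l <= p-2, is
   the identity or i |-> l-1-i: conjugating the translation by 1 into that by [a],
   it turns the unique point leaving the interval under the former into the unique
   one leaving it under the latter, while for 2 <= a <= p-2 at least two points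
   leave. *)
Lemma norm_cycle_perm_take s (Us : uniq s) x0 l z :
  prime (size s) -> 1 < l -> l.+1 < size s -> z \in 'N(<[cycle_perm Us]>) ->
  {in take l s, forall t, z t \in take l s} ->
  {in s, forall t, z t = t} \/ z (nth x0 s l.-1) = nth x0 s 0.
Proof.
move=> p_pr l1 lp zN zI; set c := cycle_perm Us in zN *; set p := size s in p_pr lp *.
have oc : #[c] = p := order_cycle_perm Us p_pr.
have p0 := prime_gt0 p_pr.
have ltp : l < p := ltnW lp.
have memI i : i < p -> (nth x0 s i \in take l s) = (i < l).
  by move=> ip; rewrite in_take ?mem_nth // index_uniq.
have zIE t : (z t \in take l s) = (t \in take l s).
  pose I := [set t in take l s].
  have zII : z @: I = I.
    apply/eqP; rewrite eqEcard card_imset ?leqnn ?andbT; last exact: perm_inj.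
    by apply/subsetP => _ /imsetP[u uI ->]; rewrite inE in uI; rewrite inE zI.
  have := mem_imset I t (@perm_inj _ z); rewrite zII !inE.
  exact.
have : c ^ z \in <[c]> by rewrite memJ_norm ?cycle_id.
case/cyclePmin => a; rewrite oc => ap cz.
have comm t : (c ^+ a) (z t) = z (c t) by rewrite -cz permJ.
(* Pulled back by [z], a point leaving the interval under translation by [a] leaves it under [c], so
   is the last point. *)
have exit i : i < l -> l <= (i + a) %% p -> nth x0 s i = z (nth x0 s l.-1).
  move=> il ia; have ip : i < p := ltn_trans il ltp.
  set u := nth x0 s i; pose t := z^-1 u.
  have zt : z t = u by rewrite permKV.
  have tI : t \in take l s by rewrite -zIE zt memI.
  have ts : t \in s := mem_take tI.
  have : c t \notin take l s.
    by rewrite -zIE -comm zt cycle_permX_nth // memI ?ltn_mod // -leqNgt.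
  rewrite -zt -{2}(nth_index x0 ts); move: tI; rewrite in_take // => tl.
  rewrite -[X in c X](nth_index x0 ts) cycle_perm_nth ?index_mem // memI ?ltn_mod //.
  rewrite modn_small; last by apply: leq_trans ltp.
  by rewrite -leqNgt => lt; have -> : index t s = l.-1 by lia.
have uniq_exit i j : i < l -> j < l -> l <= (i + a) %% p -> l <= (j + a) %% p -> i = j.
  move=> il jl ia ja; apply/eqP.
  rewrite -(nth_uniq x0 _ _ Us) ?(ltn_trans _ ltp) //.
  by rewrite (exit i) // (exit j).
case: (posnP a) => [a0 | a0].
  move: cz; rewrite a0 expg0 => /eqP; rewrite conjg_eq1 => /eqP c1.
  by move: p_pr; rewrite -oc c1 order1.
(* For a = 1 the exit point is the last one, so [z] fixes it; commuting with [c], it fixes all of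
   [s]. *)
have [a1 | a1] := eqVneq a 1%N.
  left => t ts; rewrite a1 expg1 in cz.
  have ll : l.-1 < p by lia.
  have fixl : z (nth x0 s l.-1) = nth x0 s l.-1.
    by rewrite -(exit l.-1) // ?a1 ?modn_small; lia.
  have -> : t = (c ^+ (p - l.-1 + index t s)) (nth x0 s l.-1).
    rewrite cycle_permX_nth // addnA subnKC; last exact: ltnW.
    by rewrite modnDl modn_small ?index_mem // nth_index.
  by rewrite -permJ conjXg cz fixl.
(* For a = p - 1 the exit point is 0. *)
have [ap1 | ap1] := eqVneq a p.-1.
  by right; rewrite -(exit 0) // ?modn_small; lia.
(* Two distinct exit points: l - a and l - a + 1 if a < l, otherwise 0 and 1. *)
have [al | la] := ltnP a l.
  have : l - a = l - a + 1 by apply: uniq_exit; rewrite ?modn_small; lia.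
  by lia.
have : 0 = 1%N by apply: uniq_exit; rewrite ?modn_small; lia.
by [].
Qed.

(** Take x = c w with w a cycle on the complement of [s]. The complement has at least two points, so
    x is fixed-point-free, and fewer than p, so w has order prime to p and c is a power of x. *)
Lemma exists_sol_norm_cycle s (Us : uniq s) : prime (size s) ->
  #|T| < 2 * size s -> size s + 2 <= #|T| ->
  exists2 x : {perm T}, forall t, x t != t &
    forall z, solvable <<[set x; z]>> -> z \in 'N(<[cycle_perm Us]>).
Proof.
move=> p_pr T2p pT; pose r := [seq t <- enum T | t \notin s].
have Ur : uniq r := filter_uniq _ (enum_uniq T).
have mr t : (t \in r) = (t \notin s) by rewrite mem_filter mem_enum andbT.
have szr : (size r + size s = #|T|)%N.
  have -> : size r = #|[pred t | t \notin s]|.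
    by rewrite -(card_uniqP Ur); apply: eq_card => t; rewrite mr.
  by rewrite -(card_uniqP Us) addnC cardC.
have r1 : 1 < size r by rewrite -(ltn_add2r (size s)) szr add1n -addn2.
have rs : size r < size s by rewrite -(ltn_add2r (size s)) szr addnn -mul2n.
clearbody r; set c := cycle_perm Us; pose w := cycle_perm Ur.
have ms t : (c t != t) = (t \in s) by rewrite cycle_perm_moved ?prime_gt1.
have mw t : (w t != t) = (t \notin s) by rewrite cycle_perm_moved ?mr.
have cs t : t \in s -> w t = t by move=> ts; apply/eqP; rewrite -[_ == _]negbK mw ts.
have ws t : t \notin s -> c t = t by move=> ts; apply/eqP; rewrite -[_ == _]negbK ms.
have c_in t : (c t \in s) = (t \in s).
  by rewrite -!ms (inj_eq perm_inj).
have w_in t : (w t \in s) = (t \in s).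
  by apply: negb_inj; rewrite -!mw (inj_eq perm_inj).
have cw : commute c w.
  apply/permP => t; rewrite !permM; have [ts | ts] := boolP (t \in s).
    by rewrite !cs // c_in.
  by rewrite !ws // w_in.
exists (c * w) => [t | z].
  rewrite permM; have [ts | ts] := boolP (t \in s).
    by rewrite cs ?c_in // ms.
  by rewrite ws // mw.
set H := <<_>> => solH.
have xH : c * w \in H by rewrite mem_gen // !inE eqxx.
have zH : z \in H by rewrite mem_gen // !inE eqxx orbT.
have cH : c \in H.
  rewrite -cycle_subG; apply: (subset_trans (cycleMsub cw _)); last by rewrite cycle_subG.
  rewrite order_cycle_perm // prime_coprime //; apply/negP => dv.
  have : size s %| size r by apply: dvdn_trans dv _; rewrite order_dvdn cycle_perm_size.
  by rewrite gtnNdvd // ltnW.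
apply: subsetP zH; apply: (sub_norm_cycle_of_sol p_pr T2p solH cH _ xH).
- exact: order_cycle_perm.
- by apply: commute_sym; apply: commuteM => //; apply: commute_refl.
- move=> t; rewrite permM; have [ts | ts] := boolP (t \in s).
    by rewrite cs ?c_in // ms.
  by rewrite ws // mw.
Qed.

End CyclePerm.

(** * Two fixed-point-free permutations without a common soluble neighbour *)

Section CommonNeighbours.
Local Open Scope group_scope.
Variable T : finType.

(* Two p-cycles will be laid out as (a b X J) and (b a X K): they overlap in
   3 <= l+3 <= p-2 points and miss at most one point, the one in L. *)
Lemma exists_overlapping_layout p : prime p -> #|T| + 2 <= 2 * p -> p + 2 <= #|T| ->
  exists l (a b : T) X J K L,
    [/\ enum T = [:: a, b & X ++ J ++ K ++ L], size X = l.+1,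
        (l.+3 + size J = p)%N, size K = size J & (1 < size J) && (size L <= 1)].
Proof.
rewrite cardE => p_pr Tp pT; set n := size (enum T) in Tp pT.
have p5 : 4 < p.
  have p4 : p != 4 by apply: contraTneq p_pr => ->.
  by lia.
(* The two supports cover 2p - l - 3 points: all of them for l = 2p - n - 3; if n = 2p - 2, then l =
   0 leaves one point over. *)
have [l [l3 lp ln]] : exists l, [/\ l.+4 < p, l.+3 + 2 * (p - l.+3) <= n &
    n <= (l.+3 + 2 * (p - l.+3)).+1]%N.
  case: (ltnP 2 (2 * p - n)) => ?; [exists (2 * p - n - 3)%N | exists 0%N]; split; lia.
move: (enum T) @n Tp pT lp ln => E n Tp pT lp ln; subst n.
case: E Tp pT lp ln => [|a [|b E]] /= Tp pT lp ln; try lia.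
pose m := (p - l.+3)%N.
exists l, a, b, (take l.+1 E), (take m (drop l.+1 E)),
  (take m (drop m (drop l.+1 E))), (drop m (drop m (drop l.+1 E))).
rewrite !cat_take_drop !size_drop !size_takel ?size_drop; try lia.
by split => //; lia.
Qed.

Lemma exists_no_common_neighbour p :
  prime p -> #|T| + 2 <= 2 * p -> p + 2 <= #|T| ->
  exists x y : {perm T}, [/\ forall t, x t != t, forall t, y t != t &
    forall z, solvable <<[set x; z]>> -> solvable <<[set y; z]>> -> z = 1].
Proof.
move=> p_pr Tp pT; have [l [a [b [X [J [K [L]]]]]]] := exists_overlapping_layout p_pr Tp pT.
case=> eT szX szJ szK /andP[J1 szL].
pose s := [:: a, b & X ++ J]; pose s' := [:: b, a & X ++ K].
have UE := enum_uniq T; rewrite eT in UE.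
have Us : uniq s.
  by apply: subseq_uniq UE; rewrite /= !eqxx catA prefix_subseq.
have eqE : perm_eq [:: a, b & X ++ J ++ K ++ L] ([:: b, a & X ++ K] ++ (J ++ L)).
  apply/seq.permP => P /=; rewrite !count_cat; lia.
have Us' : uniq s'.
  by move: UE; rewrite (perm_uniq eqE) cat_uniq => /andP[].
have ss : size s = p by rewrite /= size_cat; lia.
have ss' : size s' = p by rewrite /= size_cat; lia.
have T2p : #|T| < 2 * p by apply: leq_trans Tp; rewrite addn2.
have [|||x xf xN] := exists_sol_norm_cycle Us; rewrite ?ss //.
have [|||y yf yN] := exists_sol_norm_cycle Us'; rewrite ?ss' //.
exists x, y; split=> // z /xN zN /yN zN'.
have tk : take l.+3 s = [:: a, b & X] by rewrite /= -szX take_size_cat.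
have tk' : take l.+3 s' = [:: b, a & X] by rewrite /= -szX take_size_cat.
have JK t : t \in J -> t \in K -> false.
  move=> tJ tK; move: UE; rewrite /= !cat_uniq => /and3P[_ _ /and3P[_ _ /and3P[_]]].
  by case/hasP; exists t => //; rewrite mem_cat tK.
(* [z] preserves both supports, which meet exactly in this segment because J and K are disjoint. *)
have zI t : t \in [:: a, b & X] -> z t \in [:: a, b & X].
  move=> tX.
  have ts : t \in s by move: tX; rewrite /s !inE mem_cat => /or3P[] ->; rewrite ?orbT.
  have ts' : t \in s' by move: tX; rewrite /s' !inE mem_cat => /or3P[] ->; rewrite ?orbT.
  have := norm_cycle_perm_mem _ zN ts; have := norm_cycle_perm_mem _ zN' ts'.
  rewrite ss ss' prime_gt1 // /s /s' !inE !mem_cat => /(_ isT) h /(_ isT) h'.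
  case/or4P: h => [-> | -> | -> | zK]; rewrite ?orbT //.
  by case/or4P: h' => [-> | -> | -> | zJ]; rewrite ?orbT //; have := JK _ zJ zK.
have l3 : l.+4 < p by lia.
have zA : {in s, forall t, z t = t} \/ z (nth a s l.+2) = a.
  by apply: (norm_cycle_perm_take a (l := l.+3) _ _ _ zN); rewrite ?ss ?tk.
have zB : {in s', forall t, z t = t} \/ z (nth a s' l.+2) = b.
  apply: (norm_cycle_perm_take a (l := l.+3) _ _ _ zN'); rewrite ?ss' ?tk' // => t.
  have swap u : (u \in [:: b, a & X]) = (u \in [:: a, b & X]).
    by rewrite !inE orbCA.
  by rewrite !swap; exact: zI.
have e1 : nth a s l.+2 = nth a X l by rewrite /= nth_cat szX ltnSn.
have e2 : nth a s' l.+2 = nth a X l by rewrite /= nth_cat szX ltnSn.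
rewrite e1 in zA; rewrite e2 in zB.
have uX : nth a X l \in X by rewrite mem_nth // szX.
have [aX bX ab] : [/\ a \notin X, b \notin X & a != b].
  have := Us; rewrite /s /= !inE !mem_cat !negb_or.
  by case/andP => /and3P[-> -> _] /andP[/andP[-> _] _].
have ina u : u \in X -> z a = a -> z u = a -> False.
  move=> uX' za zu; have ua : u = a by apply: (@perm_inj _ z); rewrite za.
  by rewrite -ua uX' in aX.
have inb u : u \in X -> z b = b -> z u = b -> False.
  move=> uX' zb zu; have ub : u = b by apply: (@perm_inj _ z); rewrite zb.
  by rewrite -ub uX' in bX.
(* If both actions are trivial, at most the one point of L could move, so z = 1. The mixed cases
   contradict injectivity at [b] or [a]; two reflections give a = b. *)
case: zA zB => [fA | zA] [fB | zB].
- apply/permP => t; rewrite perm1.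
  have inL u : z u != u -> u \in L.
    move=> zu; have : u \in enum T by rewrite mem_enum.
    rewrite eT (perm_mem eqE) mem_cat => /orP[us' | ].
      by rewrite fB ?eqxx // in zu.
    rewrite mem_cat => /orP[uJ | //].
    by rewrite fA ?eqxx // /s !inE mem_cat uJ !orbT in zu.
  apply/eqP; apply: contraT => zt; have tL := inL _ zt.
  have ztL : z t \in L by apply: inL; rewrite (inj_eq perm_inj).
  case: L szL tL ztL {inL eT UE eqE} => [|u [|//]] // _.
  by rewrite !inE => /eqP tu /eqP zu; rewrite zu tu eqxx in zt.
- by case: (inb _ uX _ zB); apply: fA; rewrite !inE eqxx orbT.
- by case: (ina _ uX _ zA); apply: fB; rewrite !inE eqxx orbT.
- by rewrite -zA zB eqxx in ab.
Qed.

End CommonNeighbours.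

(** * Involutions *)

Section Involutions.
Local Open Scope group_scope.

Lemma solvable_gen2_norm (gT : finGroupType) (x y : gT) :
  y \in 'N(<[x]>) -> solvable <<[set x; y]>>.
Proof.
move=> yN; have -> : <<[set x; y]>> = <[x]> <*> <[y]>.
  by rewrite joing_idl joing_idr.
have nYX : <[y]> \subset 'N(<[x]>) by rewrite cycle_subG.
rewrite (@series_sol _ _ <[x]>) ?normalYl //.
by rewrite quotientYidl // quotient_sol ?abelian_sol ?cycle_abelian.
Qed.

Lemma invert_norm_cycle (gT : finGroupType) (x y : gT) :
  x ^ y = x^-1 -> y \in 'N(<[x]>).
Proof. by move=> xy; rewrite inE -cycleJ xy cycleV. Qed.

(** [t] inverts the rotation [s * t], and these two elements generate [s] as well. *)
Lemma solvable_gen2_dihedral (gT : finGroupType) (s t : gT) :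
  #[s] = 2 -> #[t] = 2 -> solvable <<[set s; t]>>.
Proof.
move=> os ot; have sol : solvable <<[set s * t; t]>>.
  apply: solvable_gen2_norm; apply: invert_norm_cycle.
  have tt : t * t = 1 by rewrite -{1}(invg2id ot) mulVg.
  by rewrite invMg conjgE (invg2id os) (invg2id ot) -!mulgA tt mulg1.
apply: solvableS sol; rewrite gen_subG subUset !sub1set; set G := generated_group _.
have stG : s * t \in G by rewrite mem_gen // !inE eqxx.
have tG : t \in G by rewrite mem_gen // !inE eqxx orbT.
by rewrite tG andbT -(groupMr _ tG).
Qed.

Variable T : finType.
Implicit Types x y z : {perm T}.

(** Choose a root r in each orbit of x and reflect the orbit about it, sending x^k r to x^-k r. *)
Lemma exists_inverting_perm x :
  exists2 y : {perm T}, y * y = 1 & x ^ y = x^-1.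
Proof.
pose r t := froot x t; pose j t := findex x (r t) t.
have symx : connect_sym (frel x) := fconnect_sym (@perm_inj _ x).
have jE t : (x ^+ j t) (r t) = t.
  by rewrite permX iter_findex // symx connect_root.
have rX k t : r ((x ^+ k) t) = r t.
  by apply/esym/(rootP symx); rewrite permX fconnect_iter.
pose f t := ((x ^+ j t)^-1) (r t).
(* The reflection does not depend on the exponent chosen to reach a point from its root. *)
have fX k t : f ((x ^+ k) (r t)) = ((x ^+ k)^-1) (r t).
  have rr : r (r t) = r t by apply: root_root.
  rewrite /f rX rr; set m := j _.
  have em : (x ^+ m) (r t) = (x ^+ k) (r t).
    by rewrite -[RHS]jE rX rr.
  apply: (@perm_inj _ (x ^+ m * x ^+ k)); rewrite -!permM mulKg.
  by rewrite (commuteX2 m k (commute_refl x)) mulKg.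
have fV k t : f (((x ^+ k)^-1) (r t)) = (x ^+ k) (r t).
  have : (x ^+ k)^-1 \in <[x]> by rewrite groupV mem_cycle.
  by case/cycleP => m e; rewrite e fX -e invgK.
have ff : involutive f by move=> t; rewrite {2}/f fV jE.
pose y := perm (can_inj ff); have yE t : y t = f t by rewrite permE.
exists y; first by apply/permP => t; rewrite perm1 permM !yE ff.
apply: (mulgI y); rewrite -conjgC; apply/permP => t; rewrite !permM !yE.
rewrite -{1}(jE t) -permM -expgSr fX expgS invMg permM //.
Qed.

Lemma exists_inverting_invol x : x * x != 1 ->
  exists2 y : {perm T}, #[y] = 2 & x ^ y = x^-1.
Proof.
move=> x2; have [y yy xy] := exists_inverting_perm x; exists y => //.
apply: nt_prime_order => //; apply: contraNneq x2 => y1.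
by move: xy; rewrite y1 conjg1 => {2}->; rewrite mulgV.
Qed.

(** If x^2 != 1, an inverting involution serves. Otherwise every involution generates a soluble
    group with x, and one of the transpositions (a b), (a c) differs from x. *)
Lemma exists_sol_invol x : 2 < #|T| ->
  exists y : {perm T}, [/\ #[y] = 2, x != y & solvable <<[set x; y]>>].
Proof.
rewrite cardE; case: (enum T) (enum_uniq T) => [|a [|b [|c s]]] // U _.
have [ab ac bc] : [/\ a != b, a != c & b != c].
  by move: U; rewrite /= !inE !negb_or => /and3P[/and3P[-> -> _] /andP[-> _]].
have otp u v : u != v -> #[tperm u v] = 2.
  move=> uv; apply: nt_prime_order => //; first by rewrite expgS expg1 tperm2.
  apply: contraNneq uv => e; have := tpermL u v; rewrite e perm1.
  by move->.
have [x2 | x2] := eqVneq (x * x) 1; last first.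
  have [y oy xy] := exists_inverting_invol x2; exists y; split=> //.
    apply: contraNneq x2 => e; move: xy; rewrite -e conjgE mulKg => {1}->.
    by rewrite mulVg.
  by apply/solvable_gen2_norm/invert_norm_cycle.
have sol y : #[y] = 2 -> solvable <<[set x; y]>>.
  have [-> oy | x1 oy] := eqVneq x 1.
    by apply: solvable_gen2_norm; rewrite cycle1 norm1 inE.
  by apply: solvable_gen2_dihedral => //; apply: nt_prime_order; rewrite // expgS expg1.
have [e | ne] := eqVneq x (tperm a b); last by exists (tperm a b); rewrite otp ?sol ?otp.
exists (tperm a c); split; rewrite ?sol ?otp //.
rewrite e; apply: contraNneq bc => e'; have := tpermL a b.
by rewrite e' tpermL => ->.
Qed.

End Involutions.

(** * The soluble graph *)

Section Diameter.
Variables (T : finType) (e : rel T).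

Lemma big_omax_eq (I : finType) (V : {set I}) (F : I -> option nat) d i :
  (forall j, j \in V -> if F j is Some m then m <= d else false) ->
  i \in V -> F i = Some d -> \big[omax/Some 0]_(j in V) F j = Some d.
Proof.
move=> Fd iV Fi.
(* Over a list, the maximum stays at most d and equals d once [i] has occurred. *)
suff H r : (forall j, j \in r -> j \in V) ->
    exists2 m, \big[omax/Some 0]_(j <- r) F j = Some m &
               m <= d /\ (i \in r -> m = d).
  rewrite -big_filter; have [|m -> [_ -> //]] := H [seq j <- index_enum I | j \in V].
    by move=> j; rewrite mem_filter => /andP[].
  by rewrite mem_filter iV mem_index_enum.
elim: r => [|j r IHr] rV; first by exists 0; rewrite ?big_nil.
have [k kr|m e1 [md mi]] := IHr; first by apply: rV; rewrite inE kr orbT.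
have := Fd j (rV j (mem_head _ _)); case Fj: (F j) => [f|] // fd.
rewrite big_cons e1 Fj /=; exists (maxn f m) => //.
rewrite geq_max fd md; split=> //; rewrite inE => /orP[/eqP ij | /mi ->].
  by move: Fj; rewrite -ij Fi => -[<-]; apply/maxn_idPl.
exact/maxn_idPr.
Qed.

(** The inner maximum is d at [x] and at most d elsewhere, so the outer one is d. *)
Lemma diameter_eq (V : {set T}) d x y : x \in V -> y \in V ->
  {in V &, forall u v, exists2 k, k <= d & walk e k u v} ->
  (forall k, k < d -> ~~ walk e k x y) -> diameter e V = Some d.
Proof.
move=> xV yV Vd nxy.
have le u v : u \in V -> v \in V ->
    if dist e u v is Some m then m <= d else false.
  by move=> uV vV; apply/dist_leP; exact: Vd.
have dxy : dist e x y = Some d.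
  have := le x y xV yV; case E: (dist e x y) => [m|] // md.
  congr Some; apply/eqP; rewrite eqn_leq md leqNgt; apply/negP => ltmd.
  have /dist_leP[k km] : is_true (if dist e x y is Some f then f <= m else false).
    by rewrite E.
  by apply/negP/nxy; apply: leq_ltn_trans ltmd.
rewrite /diameter; apply: (@big_omax_eq _ V _ d x) => // [u uV|]; last first.
  by apply: (@big_omax_eq _ V _ d y) => // v; exact: le.
suff : exists2 m, \big[omax/Some 0]_(v in V) dist e u v = Some m & m <= d.
  by case=> m ->.
apply: (big_ind (fun o => exists2 m, o = Some m & m <= d)); first by exists 0.
  by move=> _ _ [m -> md] [f -> fd]; exists (maxn m f); rewrite // geq_max md.
by move=> v vV; have := le u v uV vV; case: dist => // m md; exists m.
Qed.

End Diameter.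

Section SolGraph.
Local Open Scope group_scope.
Variables (n : nat) (hn : 7 <= n).
Notation G := [set: 'S_n]%G.

(** A radical element z generates with any t a subgroup of the soluble group R<t>; applying this to
    the pair x, y gives z = 1. *)
Lemma sol_radical_Sym : sol_radical G = 1%G.
Proof.
have [p p_pr /andP[np pn]] := bertrand_shifted hn.
have [||x [y [_ _ xy]]] := @exists_no_common_neighbour 'I_n p p_pr; rewrite ?card_ord //.
have /andP[nR sR] := sol_radical_normal_sol G.
apply/val_inj/eqP; rewrite /= -subG1; apply/subsetP => z zR; apply/set1P.
have sol (t : 'S_n) : solvable <<[set t; z]>>.
  have nt : <[t]> \subset 'N(sol_radical G).
    by apply: subset_trans (normal_norm nR); rewrite subsetT.
  apply: (@solvableS _ (sol_radical G <*> <[t]>)).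
    rewrite gen_subG subUset !sub1set; apply/andP; split.
      by rewrite mem_gen // inE cycle_id orbT.
    by rewrite mem_gen // inE zR.
  rewrite (@series_sol _ _ (sol_radical G)) ?normalYl // sR.
  by rewrite quotientYidl // quotient_sol ?abelian_sol ?cycle_abelian.
exact: xy.
Qed.

Lemma mem_sol_vertices_Sym (x : 'S_n) : (x \in sol_vertices G) = (x != 1).
Proof. by rewrite /sol_vertices sol_radical_Sym !inE andbT. Qed.

Lemma sol_adj_Sym (x y : 'S_n) :
  sol_adj G x y = [&& x != 1, y != 1, x != y & solvable <<[set x; y]>>].
Proof. by rewrite /sol_adj /= !mem_sol_vertices_Sym. Qed.

Lemma exists_adj_invol (x : 'S_n) : x != 1 ->
  exists2 y : 'S_n, sol_adj G x y & #[y] = 2.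
Proof.
move=> x1; have [|y [oy xy sxy]] := exists_sol_invol x.
  by rewrite card_ord; apply: leq_trans hn.
exists y => //; rewrite sol_adj_Sym x1 xy sxy andbT /= andbT.
by apply: contra_eq_neq oy => ->; rewrite order1.
Qed.

Lemma sol_diameter_Sym : sol_diameter G = Some 3.
Proof.
have [p p_pr /andP[np pn]] := bertrand_shifted hn.
have [||x [y [xf yf xy]]] := @exists_no_common_neighbour 'I_n p p_pr; rewrite ?card_ord //.
have n0 : 0 < n by apply: leq_trans hn.
have x1 : x != 1 by apply: contraNneq (xf (Ordinal n0)) => ->; rewrite perm1.
have y1 : y != 1 by apply: contraNneq (yf (Ordinal n0)) => ->; rewrite perm1.
have refl (z : 'S_n) : solvable <<[set z; z]>>.
  by rewrite setUid abelian_sol ?cycle_abelian.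
have symG (u v : 'S_n) : sol_adj G u v = sol_adj G v u.
  by rewrite !sol_adj_Sym setUC [u == v]eq_sym andbCA.
apply: (@diameter_eq _ _ _ 3 x y); rewrite ?mem_sol_vertices_Sym //; last move=> k k3.
  (* The walk is u, s, t, v with involutions [s] and [t]; it shortens to length 2 when s = t. *)
  move=> u v; rewrite !mem_sol_vertices_Sym => u1 v1.
  have [s us os] := exists_adj_invol u1; have [t vt ot] := exists_adj_invol v1.
  have [st | st] := eqVneq s t.
    exists 2 => //; apply/existsP; exists [tuple s; v].
    by rewrite /= us symG st vt eqxx.
  exists 3 => //; apply/existsP; exists [tuple s; t; v].
  rewrite /= us (symG t v) vt eqxx andbT !andbT /= sol_adj_Sym st.
  rewrite solvable_gen2_dihedral // !andbT.
  by apply/andP; split; apply/eqP => e; move: os ot; rewrite e order1.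
(* A walk of length 0, 1 or 2 would provide a nontrivial z soluble with both ends: x, y or the
   middle vertex. *)
apply/negP => /existsP[[s /= /eqP sk]] /andP[].
case: s sk => [|u [|v [|w s]]] /= sk; last by rewrite -sk in k3.
- by move=> _ /eqP e; case/eqP: x1; apply: xy => //; rewrite -e.
- rewrite andbT sol_adj_Sym => /and4P[_ _ _ su] /eqP e.
  by case/eqP: y1; apply: xy => //; rewrite -e.
- rewrite andbT !sol_adj_Sym => /andP[/and4P[_ /eqP u1 _ xu] /and4P[_ _ _ uv]].
  by move=> /eqP e; case: u1; apply: xy => //; rewrite setUC -e.
Qed.

End SolGraph.

Theorem theorem5p1 (n : nat) (hn : 7 <= n) :
  sol_diameter [set: 'S_n]%G = Some 3 /\
  (forall x : 'S_n, x \in sol_vertices [set: 'S_n]%G ->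
     exists2 y : 'S_n, sol_adj [set: 'S_n]%G x y & #[y]%g = 2).
Proof.
split; first exact: sol_diameter_Sym.
by move=> x; rewrite mem_sol_vertices_Sym //; apply: exists_adj_invol.
Qed.
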